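(* Let $f\in\ell^1(\mathbb{Z})$, and set $M=\sum_{j\in\mathbb{Z}}f(j)$ and $u(t;j)=\sum_{k\in\mathbb{Z}}h_t^{\mathbb{Z}}(j-k)f(k)$, where $h_t^{\mathbb{Z}}$ is the heat kernel on $\mathbb{Z}$. Then for every $1\le p<\infty$, $$\|h_t^{\mathbb{Z}}\|_{\ell^p(\mathbb{Z})}^{-1}\,\big\|u(t;\cdot)-M\,h_t^{\mathbb{Z}}\big\|_{\ell^p(\mathbb{Z})}\longrightarrow0\qquad\text{as } t\to+\infty.$$
   Context: The Laplacian on $\mathbb{Z}$ is $\mathcal{L}^{\mathbb{Z}}f(j)=f(j)-\frac{f(j+1)+f(j-1)}2$, and $h_t^{\mathbb{Z}}$ is the convolution kernel of $e^{-t\mathcal{L}^{\mathbb{Z}}}$, i.e. $h_t^{\mathbb{Z}}(j)=e^{-t}I_{|j|}(t)$ for $t>0$, $j\in\mathbb{Z}$, with $I_\nu$ the modified Bessel function of the first kind. *)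

(* Defs.v *)
From HB Require Import structures.
From mathcomp Require Import all_boot all_order all_algebra.
From mathcomp Require Import all_classical all_reals all_analysis.
From mathcomp Require Import complex.

Set Implicit Arguments.
Unset Strict Implicit.
Unset Printing Implicit Defensive.

Import Order.TTheory GRing.Theory Num.Theory.
Import numFieldNormedType.Exports.

Local Open Scope classical_set_scope.
Local Open Scope ring_scope.
Local Open Scope complex_scope.

(* The integers carry the discrete sigma-algebra, so that sums and l^p norms
   over them are integrals and L^p norms for the counting measure. *)
HB.instance Definition _ := isPointed.Build int (Posz 0).
HB.instance Definition _ := @isMeasurable.Build default_measure_display
  int discrete_measurable discrete_measurable0
  discrete_measurableC discrete_measurableU.

(* The modified Bessel function of the first kind, of integer order nu >= 0:
   the factor Gamma(k + nu + 1) of the usual series is (k + nu)!. *)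
Definition besselI (R : realType) (nu : nat) (t : R) : R :=
  limn (series (fun k : nat =>
    (t / 2) ^+ (2 * k + nu)%N / ((k`!)%:R * ((k + nu)`!)%:R))).

Definition heat_kernelZ (R : realType) (t : R) (j : int) : R :=
  expR (- t) * besselI `|j|%N t.

(* ('N[counting]_p of the moduli) = (\sum_j |f j|^p)^(1/p); it takes the value
   +oo exactly when f is not in l^p. *)
Definition lp_norm (R : realType) (p : R) (f : int -> R[i]) : \bar R :=
  Lnorm counting p%:E (fun j : int => (Normc.normc (f j))%:E).

Definition in_l1 (R : realType) (f : int -> R[i]) : Prop :=
  (lp_norm 1 f < +oo)%E.

(* Sum of an absolutely convergent complex family, as the integral of its real
   and imaginary parts; only meaningful for families in l^1. *)
Definition sumZ (R : realType) (f : int -> R[i]) : R[i] :=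
  (\int[counting]_(j in [set: int]) complex.Re (f j))
  +i* (\int[counting]_(j in [set: int]) complex.Im (f j)).

Definition heat_solZ (R : realType) (f : int -> R[i]) (t : R) (j : int) :
    R[i] :=
  sumZ (fun k : int => (heat_kernelZ t (j - k))%:C * f k).

(* Main.v *)
Require Import Defs.
From HB Require Import structures.
From mathcomp Require Import all_boot all_order all_algebra.
From mathcomp Require Import all_classical all_reals all_analysis.
From mathcomp Require Import complex.
From mathcomp Require Import ring lra zify.

Set Implicit Arguments.
Unset Strict Implicit.
Unset Printing Implicit Defensive.

Import Order.TTheory GRing.Theory Num.Theory.
Import numFieldNormedType.Exports.

Local Open Scope classical_set_scope.
Local Open Scope ring_scope.
Local Open Scope complex_scope.

(* Since u - M h is the sum over k of f(k) (h(. - k) - h), Jensen's inequality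
   and |x - y|^p <= |x^p - y^p| bound ||u - M h||_p^p by a constant times the
   sum over k of |f(k)| T(k), where T(k) is the l^1 distance between H = h^p and
   its translate by k. As H is even and nonincreasing away from 0, telescoping
   gives T(1) <= 2 H(0), hence T(k) <= 2 min (sum H, |k| H(0)). By dominated
   convergence in k it remains to see that H(0) / sum H -> 0, which holds once
   h_t(j) / h_t(0) stays away from 0 for each fixed j. This follows from
   I_(nu+1) <= I_nu and I_nu - I_(nu+2) = (2 (nu + 1) / t) I_(nu+1), which
   together give I_j >= (1 - j (j + 1) / t) I_0. *)

(** * Bessel functions of integer order: monotonicity in the order, and a lower bound by I_0 *)

Section BesselI.
Variable R : realType.
Implicit Types (t : R) (nu k n : nat).

Definition besselI_coeff nu t k : R :=
  (t / 2) ^+ (2 * k + nu)%N / (k`!%:R * (k + nu)`!%:R).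

Lemma besselI_coeff_ge0 nu t k : 0 <= t -> 0 <= besselI_coeff nu t k.
Proof. by move=> t0; rewrite divr_ge0 ?exprn_ge0 ?divr_ge0 ?mulr_ge0. Qed.

(** As (k + nu)! >= 1, the terms are dominated by (t / 2)^nu times those of the exponential series
    at (t / 2)^2. *)
Lemma is_cvg_besselI nu t : 0 <= t -> cvgn (series (besselI_coeff nu t)).
Proof.
move=> t0; have x0 : 0 <= t / 2 by rewrite divr_ge0.
apply: (@series_le_cvg _ _
  ((t / 2) ^+ nu *: exp_coeff ((t / 2) ^+ 2))) => [k|k|k|].
- exact: besselI_coeff_ge0.
- by rewrite mulr_ge0 ?exprn_ge0// exp_coeff_ge0// exprn_ge0.
- rewrite /besselI_coeff /exp_coeff /= exprD exprM mulrC.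
  rewrite [leRHS]mulrA [X in _ <= X / _]mulrC mulrC.
  apply: ler_wpM2l; first by rewrite mulr_ge0 ?exprn_ge0.
  rewrite invfM ler_piMr ?invr_ge0// invf_le1 ?ltr0n ?fact_gt0//.
  by rewrite ler1n fact_gt0.
- by apply: is_cvg_seriesZ; exact: is_cvg_series_exp_coeff.
Qed.

Arguments is_cvg_besselI nu [t].

Lemma besselI_ge0 nu t : 0 <= t -> 0 <= besselI nu t.
Proof.
move=> t0; apply: limr_ge; first exact: (is_cvg_besselI _ t0).
by apply: nearW => n; apply: sumr_ge0 => k _; exact: besselI_coeff_ge0.
Qed.

Lemma besselI0_gt0 t : 0 <= t -> 0 < besselI 0 t.
Proof.
move=> t0; apply: (@lt_le_trans _ _ 1) => //.
apply: limr_ge; first exact: (is_cvg_besselI _ t0).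
exists 1%N => // n /= n0; rewrite /series /= big_ltn//.
rewrite muln0 expr0 fact0 mulr1 divr1 lerDl.
by apply: sumr_ge0 => k _; exact: besselI_coeff_ge0.
Qed.

(* The square of the left-hand side is at most the product of the two terms
   on the right, since (k + 1) / (k + nu + 1) <= 1. *)
Lemma besselI_coeff_AMGM nu t k : 0 <= t ->
  besselI_coeff nu.+1 t k *+ 2 <= besselI_coeff nu t k + besselI_coeff nu t k.+1.
Proof.
move=> t0; rewrite -(ler_pXn2r (_ : 0 < 2)%N) ?nnegrE ?mulrn_wge0 ?addr_ge0
  ?besselI_coeff_ge0//.
have : 0 <= (besselI_coeff nu t k - besselI_coeff nu t k.+1) ^+ 2.
  exact: sqr_ge0.
suff : besselI_coeff nu.+1 t k ^+ 2 <=
    besselI_coeff nu t k * besselI_coeff nu t k.+1.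
  move: (besselI_coeff _ _ _) (besselI_coeff _ _ _) (besselI_coeff _ _ _).
  by move=> a b c; lra.
rewrite /besselI_coeff.
have -> : (2 * k + nu.+1 = (2 * k + nu).+1)%N by lia.
have -> : (2 * k.+1 + nu = (2 * k + nu).+2)%N by lia.
have -> : (k + nu.+1 = (k + nu).+1)%N by lia.
have -> : (k.+1 + nu = (k + nu).+1)%N by lia.
rewrite !factS !natrM !exprS.
have x0 : 0 <= t / 2 by rewrite divr_ge0.
have y0 := exprn_ge0 (2 * k + nu) x0.
move: (t / 2) ((t / 2) ^+ _) x0 y0 => x y x0 y0.
have a0 : (k`!%:R : R) > 0 by rewrite ltr0n fact_gt0.
have b0 : ((k + nu)`!%:R : R) > 0 by rewrite ltr0n fact_gt0.
move: (k`!%:R) ((k + nu)`!%:R) a0 b0 => a b a0 b0.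
have c0 : 0 < (k.+1%:R : R) by [].
have cd : k.+1%:R <= (k + nu).+1%:R :> R by rewrite ler_nat; lia.
move: (k.+1%:R) ((k + nu).+1%:R) c0 cd => c d c0 cd.
have d0 := lt_le_trans c0 cd.
rewrite -subr_ge0 [leRHS](_ : _ = (x * y / (a * b)) ^+ 2 * ((d - c) / (c * d ^+ 2))).
  by rewrite mulr_ge0 ?sqr_ge0// divr_ge0 ?subr_ge0// mulr_ge0 ?sqr_ge0// ltW.
by field; rewrite !gt_eqF.
Qed.

(** Summing the preceding inequality over k < n bounds twice a partial sum of I_(nu+1) by two copies
    of a partial sum of I_nu, one of them shifted by one index. *)
Lemma besselI_nonincreasing nu t : 0 <= t -> besselI nu.+1 t <= besselI nu t.
Proof.
move=> t0; rewrite /besselI -/(besselI_coeff _ _).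
have c0 := is_cvg_besselI nu t0; have c1 := is_cvg_besselI nu.+1 t0.
apply: limr_le => //; apply: nearW => n.
apply: (@le_trans _ _ (series (besselI_coeff nu t) n.+1)); last first.
  apply: nondecreasing_cvgn_le => //.
  by apply: nondecreasing_series => k _ _; exact: besselI_coeff_ge0.
(* The term of index n occurs only once when the bounds for k < n are added up; carrying its second
   copy on the left makes the induction close. *)
suff : series (besselI_coeff nu.+1 t) n *+ 2 + besselI_coeff nu t n <=
    series (besselI_coeff nu t) n.+1 *+ 2.
  by have := besselI_coeff_ge0 nu n t0; lra.
rewrite /series /=; elim: n => [|n IH].
  rewrite big_geq// big_nat1 mul0rn add0r mulr2n lerDl.
  exact: besselI_coeff_ge0.
rewrite big_nat_recr//= [in leRHS]big_nat_recr//=.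
by have := besselI_coeff_AMGM nu n t0; lra.
Qed.

(* Since (k + nu + 1) - k = nu + 1, the k-th term of I_nu is the (k-1)-st term
   of I_(nu+2) plus (nu + 1) / (t / 2) times the k-th term of I_(nu+1). *)
Lemma besselI_recurrence nu t : 0 < t ->
  besselI nu t = besselI nu.+2 t + nu.+1%:R / (t / 2) * besselI nu.+1 t.
Proof.
move=> t0; have t0' := ltW t0.
rewrite /besselI -!/(besselI_coeff _ _).
have H n : series (besselI_coeff nu t) n.+1 =
   series (besselI_coeff nu.+2 t) n +
   nu.+1%:R / (t / 2) * series (besselI_coeff nu.+1 t) n.+1.
  elim: n => [|n IH].
    rewrite /series /= !big_nat1 big_geq// add0r /besselI_coeff !muln0 !add0n fact0 !mul1r.
    rewrite factS natrM exprS; field.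
    by rewrite nat1r !pnatr_eq0 -lt0n fact_gt0 (gt_eqF t0).
  rewrite seriesSr IH (seriesSr (besselI_coeff nu.+2 t)).
  rewrite (seriesSr (besselI_coeff nu.+1 t) n.+1).
  suff -> : besselI_coeff nu t n.+1 = besselI_coeff nu.+2 t n +
    nu.+1%:R / (t / 2) * besselI_coeff nu.+1 t n.+1 by ring.
  rewrite /besselI_coeff.
  have -> : (2 * n.+1 + nu = (2 * n + nu).+2)%N by lia.
  have -> : (2 * n + nu.+2 = (2 * n + nu).+2)%N by lia.
  have -> : (2 * n.+1 + nu.+1 = (2 * n + nu).+3)%N by lia.
  have -> : (n + nu.+2 = (n + nu).+2)%N by lia.
  have -> : (n.+1 + nu.+1 = (n + nu).+2)%N by lia.
  have -> : (n.+1 + nu = (n + nu).+1)%N by lia.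
  rewrite !factS !natrM !exprS -!natr1 natrD.
  field.
  by rewrite !natr1 -natrD !natr1 !pnatr_eq0 -!lt0n !fact_gt0 (gt_eqF t0).
have c0 := is_cvg_besselI nu t0'; have c1 := is_cvg_besselI nu.+1 t0'.
have c2 := is_cvg_besselI nu.+2 t0'.
apply/cvg_lim => //; rewrite -cvg_shiftS; under eq_fun do rewrite H.
apply: cvgD; first exact: c2.
by apply: cvgMr; rewrite cvg_shiftS.
Qed.

Lemma besselI_le0 nu t : 0 <= t -> besselI nu t <= besselI 0 t.
Proof.
move=> t0; elim: nu => // nu; apply: le_trans.
exact: besselI_nonincreasing.
Qed.

(** The recurrence with I_(nu+2) <= I_(nu+1) and I_(nu+1) <= I_0 shows that one step of the order
    loses at most (2 (nu + 1) / t) I_0, and nu (nu + 1) + 2 (nu + 1) = (nu + 1) (nu + 2). *)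
Lemma besselI_ge_besselI0 nu t : 0 < t ->
  (1 - (nu * nu.+1)%:R / t) * besselI 0 t <= besselI nu t.
Proof.
move=> t0; elim: nu => [|nu]; first by rewrite mul0n mul0r subr0 mul1r.
have := besselI_recurrence nu t0.
have := besselI_nonincreasing nu.+1 (ltW t0).
have : nu.+1%:R / (t / 2) * besselI nu.+1 t <= nu.+1%:R / (t / 2) * besselI 0 t.
  by rewrite ler_wpM2l ?divr_ge0 ?besselI_le0 ?ltW// divr_gt0.
have -> : (nu.+1 * nu.+2 = nu * nu.+1 + 2 * nu.+1)%N by lia.
rewrite natrD natrM mulrDl !mulrBl mulrDl.
have -> : nu.+1%:R / (t / 2) * besselI 0 t = 2%:R * nu.+1%:R / t * besselI 0 t.
  by field; rewrite gt_eqF.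
lra.
Qed.
End BesselI.

(** * Sums over the integers as integrals for the counting measure, and Jensen's inequality *)

Section CountingInt.
Variable R : realType.
Local Open Scope ereal_scope.

Lemma measurable_fun_int d (T : sigmaRingType d) (D : set int) (F : int -> T) :
  measurable_fun D F.
Proof. by []. Qed.

(** The fibres of [pickle] cut the integers into countably many sets, each empty or a singleton, so
    countable additivity reduces the claim to a single point. *)
Lemma ge0_integral_countingZ (F : int -> \bar R) : (forall j, 0 <= F j) ->
  \int[counting]_j F j = \esum_(j in [set: int]) F j.
Proof.
move=> F0.
pose S n : set int := [set j | pickle j = n].
have tS : trivIset setT S by move=> m n _ _ [j [<- <-]].
have US : \bigcup_n S n = setT by apply/seteqP; split => // j _; exists (pickle j).
rewrite -US ge0_integral_bigcup// esum_bigcupT// nneseries_esumT; last first.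
  by move=> n; exact: integral_ge0.
apply: eq_esum => n _; have [[j jn]|nS] := pselect (exists j, S n j).
  have -> : S n = [set j].
    apply/seteqP; split => [i /= ni|_ -> //].
    by apply: (pcan_inj (@pickleK int)); rewrite ni jn.
  rewrite esum_set1// (@eq_integral _ _ _ _ _ (cst (F j))); last first.
    by move=> i; rewrite inE /= => ->.
  by rewrite integral_cst//= /counting asboolT// fset_set1 finmap.cardfs1 mule1.
have -> : S n = set0.
  by apply/seteqP; split => // j Sj; apply: nS; exists j.
by rewrite integral_set0 esum_set0.
Qed.

Lemma esum_swap (T1 T2 : choiceType) (a : T1 -> T2 -> \bar R) :
  (forall i j, 0 <= a i j) ->
  \esum_(i in [set: T1]) \esum_(j in [set: T2]) a i j =
  \esum_(j in [set: T2]) \esum_(i in [set: T1]) a i j.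
Proof.
move=> a0; rewrite !esum_esum//.
rewrite (reindex_esum (setT `*`` (fun=> setT)) _ (fun x => (x.2, x.1)))//.
split=> //=; first by move=> [i1 i2] [j1 j2] /= _ _ [] -> ->.
by move=> [i1 i2] [_ _] /=; exists (i2, i1).
Qed.

Lemma ge0_esumZl (F : int -> \bar R) (c : \bar R) : 0 <= c ->
  (forall j, 0 <= F j) ->
  \esum_(j in [set: int]) (c * F j) = c * \esum_(j in [set: int]) F j.
Proof.
move=> c0 F0; rewrite -!ge0_integral_countingZ ?ge0_integralZl// => j.
by rewrite mule_ge0.
Qed.

Lemma esum_shift (F : int -> \bar R) (k : int) :
  \esum_(j in [set: int]) F (j + k)%R = \esum_(j in [set: int]) F j.
Proof.
rewrite [RHS](reindex_esum setT _ (fun j => (j + k)%R))//.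
split => // [x y _ _ /addIr //|y _]; exists (y - k)%R => //.
by rewrite subrK.
Qed.

(** [Negz n] is -(n + 1), so the second series runs over exactly the negative integers. *)
Lemma esumZ_split (F : int -> \bar R) : (forall j, 0 <= F j) ->
  \esum_(j in [set: int]) F j = \sum_(n <oo) F (Posz n) + \sum_(n <oo) F (Negz n).
Proof.
move=> F0; rewrite (esumID (range Posz))// !setTI.
have -> : ~` range Posz = range Negz.
  apply/seteqP; split => [[n nP|n _]|_ [n _ <-] [m _]] //=; last by exists n.
  by case: nP; exists n.
by rewrite !esum_image ?nneseries_esumT// => m n _ _ [].
Qed.

(** Hölder's inequality for w^(1/p) d and w^(1/q), with q the exponent conjugate to p. The weights
    are not normalized, hence the power p - 1 of their sum. *)
Lemma Jensen_esum (w d : int -> R) (p : R) : (1 <= p)%R ->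
  (forall k, 0 <= w k)%R -> (forall k, 0 <= d k)%R ->
  (\esum_(k in [set: int]) (w k * d k)%:E) `^ p <=
  (\esum_(k in [set: int]) (w k)%:E) `^ (p - 1) *
  \esum_(k in [set: int]) (w k * d k `^ p)%:E.
Proof.
move=> p1 w0 d0; have pp : (0 < p)%R by exact: lt_le_trans p1.
have wd0 k : 0 <= (w k * d k)%:E by rewrite lee_fin mulr_ge0.
have wdp0 k : 0 <= (w k * d k `^ p)%:E by rewrite lee_fin mulr_ge0// powR_ge0.
rewrite -!ge0_integral_countingZ//.
have W0 : 0 <= \int[counting]_k (w k)%:E.
  by apply: integral_ge0 => k _; rewrite lee_fin.
have WD0 : 0 <= \int[counting]_k (w k * d k)%:E by exact: integral_ge0.
have WDp0 : 0 <= \int[counting]_k (w k * d k `^ p)%:E by exact: integral_ge0.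
(* For p = 1 the conjugate exponent is infinite, but both sides then coincide. *)
move: p1; rewrite le_eqVlt => /predU1P[p1|p1].
  rewrite -p1 subrr poweRe0 mul1e poweRe1//.
  by under [leRHS]eq_integral do rewrite powRr1//.
pose q := (p / (p - 1))%R.
have q0 : (0 < q)%R by rewrite divr_gt0// subr_gt0.
have pq1 : (p^-1 + q^-1 = 1)%R.
  by rewrite /q invf_div; field; rewrite gt_eqF.
have := @hoelder _ int R counting (fun k => w k `^ p^-1 * d k)%R
  (fun k => w k `^ q^-1)%R p q (@measurable_fun_int _ _ _ _)
  (@measurable_fun_int _ _ _ _) pp q0 pq1.
rewrite Lnorm1 unlock /=.
under eq_integral => k _ do rewrite ger0_norm ?mulr_ge0 ?powR_ge0// mulrAC -powRD
  ?pq1 ?oner_eq0// powRr1//.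
under [X in _ <= X `^ _ * _]eq_integral => k _ do
  rewrite ger0_norm ?mulr_ge0 ?powR_ge0// powRM ?powR_ge0// -powRrM
    mulVf ?gt_eqF// powRr1//.
under [X in _ <= _ * X `^ _]eq_integral => k _ do
  rewrite ger0_norm ?powR_ge0// -powRrM mulVf ?gt_eqF// powRr1//.
move=> H.
have {}H := gt0_ler_poweR (ltW pp) _ _ H.
rewrite poweRM ?poweR_ge0// -!poweRrM mulVf ?gt_eqF// poweRe1// in H.
(* Raising Hölder's inequality to the power p turns the factor W^(1/q) into W^(p/q), and p/q = p -
   1. *)
have pqE : (q^-1 * p = p - 1)%R by rewrite /q invf_div divfK// gt_eqF.
rewrite pqE in H; rewrite [leRHS]muleC; apply: H.
  by rewrite in_itv /= WD0 leey.
by rewrite in_itv /= leey andbT mule_ge0// poweR_ge0.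
Qed.

End CountingInt.

(** * Comparison of powers of differences with differences of powers *)

Section PowerDifference.
Variable R : realType.
Implicit Types x y p : R.

(** Superadditivity of the p-th power: each q in [0, x] satisfies q^p = q q^(p-1) <= q x^(p-1), and
    the bounds for q = x - y and q = y add up to x^p. *)
Lemma powR_subr_le x y p : 0 <= y -> y <= x -> 1 <= p ->
  (x - y) `^ p <= x `^ p - y `^ p.
Proof.
move=> y0 yx p1; have p0 : 0 < p by exact: lt_le_trans p1.
have x0 := le_trans y0 yx; have xy0 : 0 <= x - y by rewrite subr_ge0.
rewrite -(mulr_powRB1 x0 p0) -(mulr_powRB1 y0 p0) -(mulr_powRB1 xy0 p0) lerBrDr.
have le q : 0 <= q -> q <= x -> q * q `^ (p - 1) <= q * x `^ (p - 1).
  by move=> q0 qx; rewrite ler_wpM2l// ge0_ler_powR ?subr_ge0.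
apply: le_trans (lerD (le _ xy0 _) (le _ y0 yx)) _; rewrite ?gerBl//.
by rewrite -mulrDl subrK.
Qed.

Lemma powR_dist_le x y p : 0 <= x -> 0 <= y -> 1 <= p ->
  `|x - y| `^ p <= `|x `^ p - y `^ p|.
Proof.
move=> x0 y0 p1; have p0 : 0 <= p by exact: le_trans p1.
wlog yx : x y x0 y0 / y <= x => [H|].
  case: (leP y x) => [|/ltW] xy; first exact: H.
  by rewrite distrC [leRHS]distrC H.
rewrite !ger0_norm ?subr_ge0 ?powR_subr_le//.
by rewrite ge0_ler_powR.
Qed.

End PowerDifference.

(** * The l^1 distance between a sequence and its translates *)

Section ShiftVariation.
Variable R : realType.
Local Open Scope ereal_scope.
Implicit Types (H : int -> R) (b : nat -> R) (k : int).

(** The T(k) of the overview, for a general sequence H. *)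
Definition shift_variation H k : \bar R :=
  \esum_(j in [set: int]) `|H (j + k)%R - H j|%:E.

Lemma shift_variationN H k : shift_variation H (- k) = shift_variation H k.
Proof.
rewrite /shift_variation -[LHS](esum_shift _ k).
by apply: eq_esum => j _; rewrite addrK distrC.
Qed.

Lemma shift_variationD H k l :
  shift_variation H (k + l) <= shift_variation H k + shift_variation H l.
Proof.
rewrite /shift_variation -[X in _ <= X + _](esum_shift _ l) -esumD//.
apply: le_esum => j _; rewrite -EFinD lee_fin addrAC addrA.
exact: ler_distD.
Qed.

Lemma shift_variation_le_sum H k : (forall j, 0 <= H j)%R ->
  shift_variation H k <= 2%:E * \esum_(j in [set: int]) (H j)%:E.
Proof.
move=> H0; rewrite mule_natl mule2n.
rewrite -[X in _ <= X + _](esum_shift _ k) -esumD; do ?by move=> *; rewrite lee_fin.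
apply: le_esum => j _; rewrite -EFinD lee_fin (le_trans (ler_normB _ _))//.
by rewrite !ger0_norm.
Qed.

Lemma nneseries_telescope_le b : (forall n, 0 <= b n)%R ->
  (forall n, b n.+1 <= b n)%R -> \sum_(n <oo) (b n - b n.+1)%:E <= (b 0)%:E.
Proof.
move=> b0 bS; apply: lime_le.
  by apply: is_cvg_nneseries => n _ _; rewrite lee_fin subr_ge0.
apply: nearW => n; rewrite sumEFin lee_fin.
rewrite (@telescope_sumr_eq _ 0 n (fun i => - b i)%R)//; last first.
  by move=> k _; rewrite opprK addrC.
by rewrite opprK addrC gerBl.
Qed.

(** The points j = n and j = -(n + 1) both contribute b n - b (n + 1), so each half-line gives a
    telescoping sum of at most b 0. *)
Lemma shift_variation1_unimodal b : (forall n, 0 <= b n)%R ->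
  (forall n, b n.+1 <= b n)%R ->
  shift_variation (fun j => b `|j|%N) 1 <= (2 * b 0)%:E.
Proof.
move=> b0 bS; rewrite /shift_variation esumZ_split; last first.
  by move=> j; rewrite lee_fin.
rewrite mulr_natl mulr2n EFinD; apply: leeD.
  apply: le_trans (nneseries_telescope_le b0 bS).
  apply: lee_nneseries => [n _ _|n _]; rewrite lee_fin//.
  have -> : (`|(Posz n + 1)%R|%N = n.+1)%N by lia.
  by rewrite absz_nat distrC ger0_norm// subr_ge0.
apply: le_trans (nneseries_telescope_le b0 bS).
apply: lee_nneseries => [n _ _|n _]; rewrite lee_fin//.
have -> : (`|(Negz n + 1)%R|%N = n)%N by lia.
have -> : (`|Negz n|%N = n.+1)%N by lia.
by rewrite ger0_norm// subr_ge0.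
Qed.

(** A shift by k >= 0 is made of k unit shifts, and subadditivity adds their costs; negative k
    follows by evenness in k. *)
Lemma shift_variation_unimodal b k : (forall n, 0 <= b n)%R ->
  (forall n, b n.+1 <= b n)%R ->
  shift_variation (fun j => b `|j|%N) k <= (`|k|%N%:R * (2 * b 0))%:E.
Proof.
move=> b0 bS.
have nat_case n : shift_variation (fun j => b `|j|%N) (Posz n) <= (n%:R * (2 * b 0))%:E.
  elim: n => [|n IH].
    by rewrite mul0r /shift_variation esum1// => j _; rewrite addr0 subrr normr0.
  rewrite -addn1 PoszD natrD mulrDl mul1r EFinD.
  apply: le_trans (shift_variationD _ _ _) _.
  by rewrite leeD// shift_variation1_unimodal.
case: k => n; first exact: nat_case.
by rewrite NegzE shift_variationN abszN nat_case.
Qed.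

(** Here e bounds the ratio of the peak b 0 to the total sum. The trivial bound yields the 1 in the
    minimum, the telescoping bound yields |k| e. *)
Lemma shift_variation_le_min b k (e : R) : (0 <= e)%R -> (forall n, 0 <= b n)%R ->
  (forall n, b n.+1 <= b n)%R ->
  ((b 0)%:E <= e%:E * \esum_(j in [set: int]) (b `|j|%N)%:E)%E ->
  shift_variation (fun j => b `|j|%N) k <=
    (2 * Num.min 1 (`|k|%N%:R * e))%:E * \esum_(j in [set: int]) (b `|j|%N)%:E.
Proof.
move=> e0 b0 bS be; case: (leP 1%R (`|k|%N%:R * e)%R) => _.
  by rewrite mulr1; exact: shift_variation_le_sum.
apply: le_trans (shift_variation_unimodal _ b0 bS) _.
rewrite mulrCA EFinM [in leRHS]EFinM -muleA.
apply: lee_wpmul2l; first by rewrite lee_fin.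
by rewrite EFinM [in leRHS]EFinM -muleA; apply: lee_wpmul2l; rewrite ?lee_fin.
Qed.

End ShiftVariation.

(** * Dominated convergence in the shift *)

Section SmallShifts.
Variable R : realType.
Local Open Scope ereal_scope.

(** The majorant is w, and for fixed k the minimum is at most |k| / (n + 1). The sequence 1 / (n +
    1) plays the part of the ratio e of peak to sum. *)
Lemma esum_min_cvg0 (w : int -> R) : (forall k, 0 <= w k)%R ->
  \esum_(k in [set: int]) (w k)%:E < +oo ->
  \esum_(k in [set: int]) (w k * Num.min 1 (`|k|%N%:R / n.+1%:R))%:E
    @[n --> \oo] --> 0.
Proof.
move=> w0 W.
have m0 (k : int) n : (0 <= Num.min 1 (`|k|%N%:R / n.+1%:R) :> R)%R.
  by rewrite le_min ler01 divr_ge0.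
have wm0 k n : 0 <= (w k * Num.min 1 (`|k|%N%:R / n.+1%:R))%:E.
  by rewrite lee_fin mulr_ge0.
under eq_fun do rewrite -ge0_integral_countingZ//.
rewrite -(@integral0 _ _ R (@counting int R) setT).
apply: (@dominated_cvg _ int R counting setT _ _ _ (fun k => (w k)%:E)) => //.
- move=> k _; apply: cvg_EFin; first by apply: nearW.
  rewrite -[X in _ --> X](mulr0 (w k)); apply: cvgMr.
  apply: (@squeeze_cvgr _ _ _ _ (cst 0%R) (fun n => `|k|%N%:R * harmonic n)%R).
  - by apply: nearW => n; rewrite m0 ge_min lexx orbT.
  - exact: cvg_cst.
  - by rewrite -[X in _ --> X](mulr0 `|k|%N%:R); apply: cvgMr; exact: cvg_harmonic.
- apply/integrableP; split => //.
  by under eq_integral do rewrite gee0_abs ?lee_fin//; rewrite ge0_integral_countingZ.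
- by move=> n k _; rewrite gee0_abs// lee_fin ler_piMr// ge_min lexx.
Qed.

End SmallShifts.

(** * The l^p estimate for a weighted sum of translation differences *)

Section LpConvolution.
Variable R : realType.
Local Open Scope ereal_scope.

(** To be used with w = |f|, D = |u - M h| and a the profile of h. In the constant, 2^p comes from
    the factor 2 in the bound on D, the power p - 1 from Jensen's inequality, and the last 2 from
    the bound on T(k). *)
Lemma esum_powR_convolution_le (w D : int -> R) (a : nat -> R) (p e : R) :
  (1 <= p)%R -> (0 <= e)%R -> (forall k, 0 <= w k)%R ->
  \esum_(k in [set: int]) (w k)%:E < +oo ->
  (forall j, 0 <= D j)%R ->
  (forall n, 0 <= a n)%R -> (forall n, a n.+1 <= a n)%R ->
  (forall j, ((D j)%:E <=
    2%:E * \esum_(k in [set: int]) (w k * `|a `|(j - k)%R|%N - a `|j|%N|)%:E)%E) ->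
  ((a 0%N `^ p)%:E <= e%:E * \esum_(j in [set: int]) (a `|j|%N `^ p)%:E)%E ->
  \esum_(j in [set: int]) (D j `^ p)%:E <=
    (2 `^ p * fine (\esum_(k in [set: int]) (w k)%:E) `^ (p - 1) * 2)%:E *
    (\esum_(k in [set: int]) (w k * Num.min 1 (`|k|%N%:R * e))%:E) *
    \esum_(j in [set: int]) (a `|j|%N `^ p)%:E.
Proof.
move=> p1 e0 w0 Wfin D0 a0 aS Da ae.
have pp : (0 < p)%R by exact: lt_le_trans p1.
set W := \esum_(k in _) (w k)%:E; set Y := \esum_(j in _) (a `|j|%N `^ p)%:E.
have W0 : 0 <= W by apply: esum_ge0 => k _; rewrite lee_fin.
have Y0 : 0 <= Y by apply: esum_ge0 => k _; rewrite lee_fin powR_ge0.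
have WE : W = (fine W)%:E by rewrite fineK// ge0_fin_numE.
pose H (j : int) : R := (a `|j|%N `^ p)%R.
pose c : R := (2 `^ p * fine W `^ (p - 1))%R.
have c0 : (0 <= c)%R by rewrite mulr_ge0 ?powR_ge0.
have wd0 j k : 0 <= (w k * `|H (j + - k)%R - H j|)%:E by rewrite lee_fin mulr_ge0.
have S0 j : 0 <= \esum_(k in [set: int]) (w k * `|a `|(j - k)%R|%N - a `|j|%N|)%:E.
  by apply: esum_ge0 => k _; rewrite lee_fin mulr_ge0.
have ptw j : (D j `^ p)%:E <=
    c%:E * \esum_(k in [set: int]) (w k * `|H (j + - k)%R - H j|)%:E.
  rewrite -poweR_EFin.
  apply: (@le_trans _ _ ((2%:E * \esum_(k in [set: int])
      (w k * `|a `|(j - k)%R|%N - a `|j|%N|)%:E) `^ p)).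
    apply: gt0_ler_poweR (Da j); first exact: ltW.
      by rewrite in_itv/= leey lee_fin D0.
    by rewrite in_itv/= leey andbT mule_ge0.
  rewrite poweRM//.
  rewrite poweR_EFin /c EFinM -muleA lee_wpmul2l ?lee_fin ?powR_ge0//.
  apply: le_trans (Jensen_esum p1 w0 _) _ => //.
  rewrite -/W {1}WE poweR_EFin lee_wpmul2l ?lee_fin ?powR_ge0//.
  by apply: le_esum => k _; rewrite lee_fin ler_wpM2l// powR_dist_le.
(* Sum the pointwise bound over j and exchange the two sums: the inner sum over j is the shift
   variation of H at -k. *)
apply: (@le_trans _ _ (c%:E * \esum_(k in [set: int])
    ((w k)%:E * shift_variation H (- k)))).
  apply: le_trans (le_esum (fun j _ => ptw j)) _.
  rewrite ge0_esumZl ?lee_fin//; last by move=> j; exact: esum_ge0.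
  rewrite esum_swap// lee_wpmul2l ?lee_fin//; apply: le_esum => k _.
  rewrite /shift_variation -ge0_esumZl ?lee_fin//.
have b0 n : (0 <= a n `^ p)%R by exact: powR_ge0.
have bS n : (a n.+1 `^ p <= a n `^ p)%R by rewrite ge0_ler_powR ?nnegrE ?(ltW pp).
rewrite -/c (EFinM c 2) -!muleA lee_wpmul2l ?lee_fin//.
rewrite [X in _ <= _ * X]muleC -ge0_esumZl//; last first.
  by move=> k; rewrite lee_fin mulr_ge0// le_min ler01 mulr_ge0.
rewrite -ge0_esumZl//; last first.
  move=> k; rewrite mule_ge0// lee_fin mulr_ge0// le_min ler01 mulr_ge0//.
apply: le_esum => k _.
apply: (@le_trans _ _ ((w k)%:E * ((2 * Num.min 1 (`|k|%N%:R * e))%:E * Y))).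
  rewrite lee_wpmul2l ?lee_fin// shift_variationN.
  exact: (shift_variation_le_min _ e0 b0 bS ae).
by rewrite [leRHS]muleCA -EFinM [leRHS]muleC muleA -EFinM mulrCA.
Qed.

End LpConvolution.

(** * The heat kernel: monotonicity and flattening for large time *)

Section HeatKernel.
Variable R : realType.

(** The kernel as a function of the distance to 0, so that the results on even unimodal sequences
    apply to it. *)
Definition heat_coeff (t : R) (n : nat) : R := expR (- t) * besselI n t.

Lemma heat_coeff_ge0 t n : 0 <= t -> 0 <= heat_coeff t n.
Proof. by move=> t0; rewrite mulr_ge0 ?expR_ge0 ?besselI_ge0. Qed.

Lemma heat_coeff0_gt0 t : 0 <= t -> 0 < heat_coeff t 0.
Proof. by move=> t0; rewrite mulr_gt0 ?expR_gt0 ?besselI0_gt0. Qed.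

Lemma heat_coeff_nonincreasing t n : 0 <= t -> heat_coeff t n.+1 <= heat_coeff t n.
Proof. by move=> t0; rewrite ler_wpM2l ?expR_ge0 ?besselI_nonincreasing. Qed.

Lemma heat_coeff_le0 t n : 0 <= t -> heat_coeff t n <= heat_coeff t 0.
Proof. by move=> t0; rewrite ler_wpM2l ?expR_ge0 ?besselI_le0. Qed.

(** For n < N one has n (n + 1) <= N^2 <= t / 2, so the factor 1 - n (n + 1) / t in the Bessel lower
    bound is at least 1/2. *)
Lemma heat_coeff_ge_half (N n : nat) (t : R) : (n < N)%N -> 0 < t ->
  2 * (N * N)%:R <= t -> 2^-1 * heat_coeff t 0 <= heat_coeff t n.
Proof.
move=> nN t0 tN; rewrite mulrCA ler_wpM2l ?expR_ge0//.
apply: le_trans (besselI_ge_besselI0 n t0).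
rewrite ler_wpM2r ?besselI_ge0 ?(ltW t0)//.
have : (n * n.+1)%:R / t <= 2^-1 :> R.
  rewrite ler_pdivrMr// mulrC ler_pdivlMr// mulrC; apply: le_trans tN.
  by rewrite ler_pM2l// ler_nat leq_mul// ltnW.
by move: (_ / t) => x; lra.
Qed.

(** For large t the N terms with 0 <= j < N are each at least 2^(-p) h_t(0)^p; it suffices that
    their number N be large. *)
Lemma heat_coeff0_negligible (p e : R) : 0 < p -> 0 < e ->
  \forall t \near +oo%R,
    ((heat_coeff t 0 `^ p)%:E <=
     e%:E * \esum_(j in [set: int]) (heat_coeff t `|j|%N `^ p)%:E)%E.
Proof.
(* N is chosen so that e N 2^(-p) >= 1. *)
move=> p0 e0; pose N := (Num.trunc (2 `^ p / e)).+1.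
have Ne : 2 `^ p <= e * N%:R.
  by rewrite mulrC -ler_pdivrMr// ltW// truncnS_gt.
near=> t.
have t0 : 0 < t by near: t; exact: nbhs_pinfty_gt.
have tN : 2 * (N * N)%:R <= t by near: t; exact: nbhs_pinfty_ge.
have H0 (j : int) : (0 <= (heat_coeff t `|j|%N `^ p)%:E)%E.
  by rewrite lee_fin powR_ge0.
apply: (@le_trans _ _ (e%:E * \sum_(0 <= n < N) (heat_coeff t n `^ p)%:E)%E).
  rewrite sumEFin -EFinM lee_fin.
  apply: (@le_trans _ _ (e * \sum_(0 <= n < N) (2 `^ p)^-1 * heat_coeff t 0 `^ p)).
    rewrite sumr_const_nat subn0 -[X in e * X]mulr_natr.
    rewrite [leRHS](_ : _ = heat_coeff t 0 `^ p * (e * N%:R / 2 `^ p)); last by ring.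
    by rewrite ler_peMr ?powR_ge0// ler_pdivlMr ?powR_gt0// mul1r.
  rewrite ler_pM2l// !big_mkord; apply: ler_sum => n _.
  have -> : (2 `^ p)^-1 = 2^-1 `^ p :> R.
    by rewrite -powR_inv1 ?powR_ge0// powRAC powR_inv1.
  rewrite -powRM ?heat_coeff_ge0 ?(ltW t0)//.
  apply: (ge0_ler_powR (ltW p0)).
  - by rewrite nnegrE mulr_ge0// heat_coeff_ge0// ltW.
  - by rewrite nnegrE heat_coeff_ge0// ltW.
  exact: (heat_coeff_ge_half (ltn_ord n)).
rewrite lee_wpmul2l ?lee_fin ?(ltW e0)// esumZ_split//.
apply: (@le_trans _ _ (\sum_(n <oo) (heat_coeff t n `^ p)%:E)%E).
  by apply: nneseries_lim_ge => n _ _; rewrite lee_fin powR_ge0.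
rewrite leeDl// nneseries_ge0//.
Unshelve. all: by end_near.
Qed.

End HeatKernel.

(** * Complex sums: norm bounds and linearity *)

Section ComplexSums.
Variable R : realType.
Import Normc.
Implicit Types (f : int -> R[i]) (p : R).

Lemma normc_ge0 (z : R[i]) : 0 <= normc z.
Proof. by case: z => x y; exact: sqrtr_ge0. Qed.

Lemma lp_normE p f :
  (lp_norm p f = (\esum_(j in [set: int]) (normc (f j) `^ p)%:E) `^ p^-1)%E.
Proof.
rewrite /lp_norm unlock -ge0_integral_countingZ; last first.
  by move=> j; rewrite lee_fin powR_ge0.
by congr poweR; apply: eq_integral => j _; rewrite /= ger0_norm ?normc_ge0.
Qed.

Lemma normr_Re_le_normc (z : R[i]) : `|complex.Re z| <= normc z.
Proof.
case: z => x y /=; rewrite -sqrtr_sqr ler_sqrt ?lerDl ?sqr_ge0//.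
by rewrite addr_ge0 ?sqr_ge0.
Qed.

Lemma normr_Im_le_normc (z : R[i]) : `|complex.Im z| <= normc z.
Proof.
case: z => x y /=; rewrite -sqrtr_sqr ler_sqrt ?lerDr ?sqr_ge0//.
by rewrite addr_ge0 ?sqr_ge0.
Qed.

Lemma normc_le_ReDIm (z : R[i]) : normc z <= `|complex.Re z| + `|complex.Im z|.
Proof.
case: z => x y /=; rewrite -[leRHS]ger0_norm ?addr_ge0// -sqrtr_sqr.
rewrite ler_sqrt ?sqr_ge0// sqrrD !real_normK ?num_real// lerD2r lerDl.
by rewrite mulrn_wge0// mulr_ge0.
Qed.

Lemma normc_real (r : R) : normc r%:C = `|r|.
Proof. by rewrite /= expr0n addr0 sqrtr_sqr. Qed.

Lemma integrable_countingZ (F G : int -> R) : (forall k, `|F k| <= G k) ->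
  (\esum_(k in [set: int]) (G k)%:E < +oo)%E ->
  (@counting int R).-integrable setT (EFin \o F).
Proof.
move=> FG Gfin; apply/integrableP; split => //.
apply: le_lt_trans Gfin; rewrite ge0_integral_countingZ//.
by apply: le_esum => k _; rewrite lee_fin.
Qed.

Lemma le_normr_sumZ (F G : int -> R) : (forall k, `|F k| <= G k) ->
  (\esum_(k in [set: int]) (G k)%:E < +oo)%E ->
  (`|\int[counting]_(k in [set: int]) F k|%:E <=
   \esum_(k in [set: int]) (G k)%:E)%E.
Proof.
move=> FG Gfin; rewrite EFin_normr_Rintegral//; last exact: integrable_countingZ Gfin.
apply: le_trans (le_abse_integral _ _ _) _ => //.
rewrite ge0_integral_countingZ//.
by apply: le_esum => k _; rewrite lee_fin.
Qed.

(** Real and imaginary parts are bounded separately, which costs the factor 2, harmless for a limit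
    equal to 0. *)
Lemma normc_sumZ_le f : (\esum_(k in [set: int]) (normc (f k))%:E < +oo)%E ->
  ((normc (sumZ f))%:E <= 2%:E * \esum_(k in [set: int]) (normc (f k))%:E)%E.
Proof.
move=> ffin; apply: (@le_trans _ _ (`|complex.Re (sumZ f)| + `|complex.Im (sumZ f)|)%:E).
  by rewrite lee_fin normc_le_ReDIm.
rewrite mule_natl mule2n EFinD; apply: leeD; apply: le_normr_sumZ => // k.
- exact: normr_Re_le_normc.
- exact: normr_Im_le_normc.
Qed.

Lemma ReMr (r : R) (z : R[i]) : complex.Re (r%:C * z) = r * complex.Re z.
Proof. by case: z => x y /=; rewrite mul0r subr0. Qed.

Lemma ImMr (r : R) (z : R[i]) : complex.Im (r%:C * z) = r * complex.Im z.
Proof. by case: z => x y /=; rewrite mul0r addr0. Qed.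

(** Used with c k = h_t(j - k) and d = h_t(j) to write u - M h as one sum. The bound C on c makes c
    f summable, so that linearity of the integral applies. *)
Lemma sumZ_subMr f (c : int -> R) (d C : R) :
  (\esum_(k in [set: int]) (normc (f k))%:E < +oo)%E ->
  (forall k, `|c k| <= C) ->
  sumZ (fun k => (c k)%:C * f k) - sumZ f * d%:C =
  sumZ (fun k => (c k - d)%:C * f k).
Proof.
move=> ffin cC; have C0 : 0 <= C by exact: le_trans (normr_ge0 _) (cC 0).
have Cfin : (\esum_(k in [set: int]) (C * normc (f k))%:E < +oo)%E.
  under eq_esum do rewrite EFinM.
  rewrite ge0_esumZl ?lee_fin//; first by rewrite lte_mul_pinfty ?lee_fin.
  by move=> k; rewrite lee_fin normc_ge0.
(* F stands for either the real or the imaginary part. *)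
have integral_part (F : R[i] -> R) : (forall z, `|F z| <= normc z) ->
    \int[counting]_(k in [set: int]) (c k * F (f k)) -
    d * \int[counting]_(k in [set: int]) F (f k) =
    \int[counting]_(k in [set: int]) ((c k - d) * F (f k)).
  move=> Fle.
  have iF : (@counting int R).-integrable setT (EFin \o (F \o f)).
    by apply: integrable_countingZ ffin => k /=.
  have icF : (@counting int R).-integrable setT (EFin \o (fun k => c k * F (f k))).
    by apply: integrable_countingZ Cfin => k /=; rewrite normrM ler_pM.
  rewrite -(RintegralZl _ _ iF)// -RintegralB//; last first.
    exact: (integrableZl measurableT d iF).
  by apply: eq_Rintegral => k _; rewrite mulrBl.
rewrite mulrC /sumZ; apply/eqP; rewrite eq_complex /=.
rewrite !mul0r subr0 addr0; apply/andP; split; apply/eqP.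
  rewrite (eq_Rintegral _ (g := fun k => c k * complex.Re (f k))); last first.
    by move=> k _; exact: ReMr.
  rewrite (integral_part _ normr_Re_le_normc).
  by apply: eq_Rintegral => k _; rewrite ReMr.
rewrite (eq_Rintegral _ (g := fun k => c k * complex.Im (f k))); last first.
  by move=> k _; exact: ImMr.
rewrite (integral_part _ normr_Im_le_normc).
by apply: eq_Rintegral => k _; rewrite ImMr.
Qed.

End ComplexSums.

(** * Limits and quotients in the extended reals *)

Section EReal.
Variable R : realType.
Local Open Scope ereal_scope.

Lemma cvg_ereal0P (T : Type) (F : set_system T) {FF : Filter F} (g : T -> \bar R) :
  (forall t, 0 <= g t) ->
  (forall e : R, (0 < e)%R -> \forall t \near F, g t <= e%:E) ->
  g t @[t --> F] --> 0.
Proof.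
move=> g0 gle; apply/fine_cvgP; split.
  near=> t; rewrite ge0_fin_numE//; apply: (@le_lt_trans _ _ 1); last exact: ltry.
  by near: t; exact: gle.
apply/cvgrPdist_le => e e0; near=> t.
have gte : g t <= e%:E by near: t; exact: gle.
have gfin : g t \is a fin_num by rewrite ge0_fin_numE// (le_lt_trans gte) ?ltry.
by rewrite /= sub0r normrN ger0_norm ?fine_ge0// -lee_fin fineK.
Unshelve. all: by end_near.
Qed.

(** The case B = +oo is covered by B^-1 = 0, so dividing by the l^p norm of the kernel asks only for
    its positivity. *)
Lemma inve_mule_le (A B : \bar R) (e : R) : (0 <= e)%R -> 0 < B ->
  A <= e%:E * B -> B^-1 * A <= e%:E.
Proof.
move=> e0; case: B => [b| |]//.
- rewrite lte_fin => b0 AB; rewrite inver gt_eqF// muleC lee_pdivrMr//.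
- by rewrite invey mul0e lee_fin.
Qed.
End EReal.

(** * Pointwise bound on u - M h, and the limit *)

Lemma normc_heat_solZ_sub_le (R : realType) (f : int -> R[i]) (t : R) (j : int) :
  0 <= t -> (\esum_(k in [set: int]) (Normc.normc (f k))%:E < +oo)%E ->
  ((Normc.normc (heat_solZ f t j - sumZ f * (heat_kernelZ t j)%:C))%:E <=
   2%:E * \esum_(k in [set: int])
     (Normc.normc (f k) *
      `|heat_coeff t `|(j - k)%R|%N - heat_coeff t `|j|%N|)%:E)%E.
Proof.
move=> t0 ffin.
(* The kernel is bounded by its value at 0. *)
rewrite /heat_solZ (@sumZ_subMr _ _ _ _ (heat_coeff t 0))//; last first.
  by move=> k; rewrite ger0_norm ?heat_coeff_ge0// heat_coeff_le0.
have E (k : int) : Normc.normc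
    ((heat_kernelZ t (j - k) - heat_kernelZ t j)%:C * f k) =
    Normc.normc (f k) * `|heat_coeff t `|(j - k)%R|%N - heat_coeff t `|j|%N|.
  by rewrite Normc.normcM normc_real mulrC.
apply: le_trans (normc_sumZ_le _) _; last by under eq_esum do rewrite E.
(* Summability: two values in [0, h_t(0)] differ by at most h_t(0), so the terms are dominated by
   h_t(0) |f k|. *)
apply: (@le_lt_trans _ _
    ((heat_coeff t 0)%:E * \esum_(k in [set: int]) (Normc.normc (f k))%:E)%E).
  rewrite -ge0_esumZl ?lee_fin ?heat_coeff_ge0//; last first.
    by move=> k; rewrite lee_fin normc_ge0.
  apply: le_esum => k _; rewrite E lee_fin mulrC ler_wpM2r ?normc_ge0//.
  rewrite ler_norml.
  have := heat_coeff_le0 `|(j - k)%R|%N t0; have := heat_coeff_le0 `|j|%N t0.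
  have := heat_coeff_ge0 `|(j - k)%R|%N t0; have := heat_coeff_ge0 `|j|%N t0.
  by move=> *; apply/andP; split; lra.
by rewrite lte_mul_pinfty ?lee_fin ?heat_coeff_ge0.
Qed.

Theorem mainTheorem3 (R : realType) (f : int -> R[i]) (hf : in_l1 f)
    (p : R) (hp : 1 <= p) :
  let M := sumZ f in
  let h := fun (t : R) (j : int) => (heat_kernelZ t j)%:C in
  let u := heat_solZ f in
  ((lp_norm p (h t))^-1 *
      lp_norm p (fun j : int => (u t j - M * h t j)%R))%E
    @[t --> +oo%R] --> 0%E.
Proof.
move=> M h u.
have p0 : 0 < p by exact: lt_le_trans hp.
have w0 (k : int) : 0 <= Normc.normc (f k) by exact: normc_ge0.
have ffin : (\esum_(k in [set: int]) (Normc.normc (f k))%:E < +oo)%E.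
  move: hf; rewrite /in_l1 lp_normE invr1 poweRe1; last first.
    by apply: esum_ge0 => k _; rewrite lee_fin powR_ge0.
  by under eq_esum do rewrite powRr1//.
apply: cvg_ereal0P => [t|e e0].
  by rewrite mule_ge0 ?inve_ge0 ?Lnorm_ge0.
pose K := 2 `^ p * fine (\esum_(k in [set: int]) (Normc.normc (f k))%:E) `^ (p - 1) * 2.
have K0 : 0 <= K by rewrite !mulr_ge0 ?powR_ge0.
(* n is fixed before t. The denominator is K + 1 since K may vanish, and K e^p / (K + 1) <= e^p at
   the end. *)
have [n Gn] : exists n : nat, (\esum_(k in [set: int])
    (Normc.normc (f k) * Num.min 1 (`|k|%N%:R / n.+1%:R))%:E <= (e `^ p / (K + 1))%:E)%E.
  have /fine_cvgP[Gfin /cvgrPdist_le/(_ (e `^ p / (K + 1)))] := esum_min_cvg0 w0 ffin.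
  move=> /(_ _)/wrap[|Gle]; first by rewrite divr_gt0 ?powR_gt0 ?ltr_wpDl.
  have [n [/= Gnfin Gnle]] := filter_ex (filterI Gfin Gle).
  exists n; rewrite -(fineK Gnfin) lee_fin; apply: le_trans Gnle.
  by rewrite sub0r normrN ler_norm.
near=> t.
have t0 : 0 <= t by near: t; exact: nbhs_pinfty_ge.
(* For t large the ratio of peak to sum falls below 1 / (n + 1), the value for which n was
   chosen. *)
have hY : ((heat_coeff t 0 `^ p)%:E <=
    (n.+1%:R^-1)%:E * \esum_(j in [set: int]) (heat_coeff t `|j|%N `^ p)%:E)%E.
  by near: t; apply: heat_coeff0_negligible; rewrite ?invr_gt0.
have Y0 : (0 <= \esum_(j in [set: int]) (heat_coeff t `|j|%N `^ p)%:E)%E.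
  by apply: esum_ge0 => j _; rewrite lee_fin powR_ge0.
have Dle (j : int) := normc_heat_solZ_sub_le j t0 ffin.
have D0 (j : int) := normc_ge0 (heat_solZ f t j - sumZ f * (heat_kernelZ t j)%:C).
have n0 : (0 <= n.+1%:R^-1 :> R) by rewrite invr_ge0.
have := esum_powR_convolution_le hp n0 w0 ffin D0 
  (fun m => heat_coeff_ge0 m t0) (fun m => heat_coeff_nonincreasing m t0) Dle hY.
have hE (j : int) : Normc.normc (h t j) = heat_coeff t `|j|%N.
  by rewrite normc_real ger0_norm// heat_coeff_ge0.
rewrite -/K !lp_normE => XY.
under [X in (X `^ _)^-1%E]eq_esum do rewrite hE.
apply: inve_mule_le; first exact: ltW.
  (* The norm of the kernel is positive: if the sum were 0, [hY] would force h_t(0)^p <= 0. *)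
  rewrite poweR_gt0// lt0e Y0 andbT; apply: contraTneq hY => ->.
  by rewrite mule0 -ltNge lte_fin powR_gt0// heat_coeff0_gt0.
(* Both sides become p-th roots, which reduces the claim to the bound on sums of p-th powers. *)
have -> : e = (e `^ p) `^ p^-1 by rewrite -powRrM mulfV ?gt_eqF// powRr1// ltW.
rewrite -poweR_EFin -poweRM ?lee_fin ?powR_ge0//.
apply: gt0_ler_poweR; rewrite ?in_itv/= ?leey ?andbT ?invr_ge0 ?(ltW p0)//.
- by apply: esum_ge0 => j _; rewrite lee_fin powR_ge0.
- by rewrite mule_ge0// lee_fin powR_ge0.
apply: le_trans XY _; rewrite lee_wpmul2r//.
apply: le_trans (lee_wpmul2l _ Gn) _; first by rewrite lee_fin.
rewrite -EFinM lee_fin mulrCA ler_piMr ?powR_ge0//.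
by rewrite ler_pdivrMr ?mul1r ?lerDl// ltr_wpDl.
Unshelve. all: by end_near.
Qed.
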